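(* In the linear model with measurement errors and the two-step optimal subsampling scheme described in the context, suppose that: (A1) the matrix $\mathcal{H}_{W}=\frac{1}{n}\sum_{i=1}^{n}\mathbf{W}_{i}\mathbf{W}_{i}^{T}-\boldsymbol{\Sigma}_{uu}$ converges in probability to a positive definite matrix; (A2) $\frac{1}{n}\sum_{i=1}^{n}\|\mathbf{W}_{i}\|^{4}=O_{P}(1)$ and $\frac{1}{n}\sum_{i=1}^{n}(y_{i}-\mathbf{W}_{i}^{T}\hat{\boldsymbol{\beta}})^{4}=O_{P}(1)$; (A3) $\max_{i=1,\ldots,n}(n\pi_{i})^{-1}=O_{P}(1)$ for the subsampling probabilities $\pi_i=\pi_i(\tilde{\boldsymbol{\beta}}_0)$. If $\tilde{\boldsymbol{\beta}}_{0}$ exists, then as $r_{0}r^{-1/2}\to 0$, $r\to\infty$ and $n\to\infty$, $\breve{\boldsymbol{\beta}}$ converges to $\hat{\boldsymbol{\beta}}$ in conditional probability given $\mathcal{F}_{n}$, with convergence rate $\sqrt{r}$. That is, with probability approaching one, for any $\varepsilon>0$ there exist finite constants $\Delta_{\varepsilon}$ and $r_{\varepsilon}$ such that $$P\big(\|\breve{\boldsymbol{\beta}}-\hat{\boldsymbol{\beta}}\|\geq r^{-1/2}\Delta_{\varepsilon}\,\big|\,\mathcal{F}_{n}\big)<\varepsilon$$ for all $r>r_{\varepsilon}$.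
   Context: Model. For $i=1,\ldots,n$, $y_{i}=\mathbf{X}_{i}^{T}\boldsymbol{\beta}+\epsilon_{i}$ and $\mathbf{W}_{i}=\mathbf{X}_{i}+\mathbf{U}_{i}$, where $\mathbf{X}_{i}$ is a $p$-dimensional covariate vector, $y_i$ is the scalar response, $\boldsymbol{\beta}\in\mathbb{R}^{p}$ is unknown, $\epsilon_{i}$ is a random error with mean zero and variance $\sigma^{2}$, and $\mathbf{U}_{i}$ is a random measurement error vector with mean zero and known covariance matrix $\boldsymbol{\Sigma}_{uu}$, independent of $\epsilon_{i}$ and $\mathbf{X}_{i}$. Only $\mathbf{W}_i$ (not $\mathbf{X}_i$) is observed. The full data are $\mathcal{F}_{n}=\{(\mathbf{W}_{i},y_{i}):i=1,\ldots,n\}$. $\|\cdot\|$ is the Euclidean norm. Full-data estimator. $\hat{\boldsymbol{\beta}}=\arg\min_{\boldsymbol{\beta}}\big\{\frac{1}{2n}\sum_{i=1}^{n}(y_{i}-\mathbf{W}_{i}^{T}\boldsymbol{\beta})^{2}-\frac12\boldsymbol{\beta}^{T}\boldsymbol{\Sigma}_{uu}\boldsymbol{\beta}\big\}=\big(\sum_{i=1}^{n}\mathbf{W}_{i}\mathbf{W}_{i}^{T}-n\boldsymbol{\Sigma}_{uu}\big)^{-1}\sum_{i=1}^{n}\mathbf{W}_{i}y_{i}$. Weighted subsample estimator. For data points $(\mathbf{W}_{i}^{*},y_{i}^{*})$, $i=1,\ldots,s$, drawn with replacement from the full data, with attached sampling probabilities $\pi_i^*$, the estimator is the minimizer over $\boldsymbol{\beta}$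 of $$\frac{1}{2n}\sum_{i=1}^{s}\frac{1}{s\pi_{i}^{*}}(y_{i}^{*}-\mathbf{W}_{i}^{*T}\boldsymbol{\beta})^{2}-\frac12\boldsymbol{\beta}^{T}\boldsymbol{\Sigma}_{uu}\boldsymbol{\beta}.$$ Two-step optimal subsampling. Step 1: draw a subsample of size $r_0$ with replacement with uniform probabilities $1/n$, and let $\tilde{\boldsymbol{\beta}}_{0}$ be the resulting weighted subsample estimator (pilot estimate). Define the probabilities $\pi_i(\tilde{\boldsymbol{\beta}}_0)$, $i=1,\dots,n$, by replacing $\hat{\boldsymbol{\beta}}$ by $\tilde{\boldsymbol{\beta}}_0$ in either $$\pi_{i}^{mV}=\frac{|y_{i}-\mathbf{W}_{i}^{T}\hat{\boldsymbol{\beta}}|\,\|\mathcal{H}_{W}^{-1}\mathbf{W}_{i}\|}{\sum_{j=1}^{n}|y_{j}-\mathbf{W}_{j}^{T}\hat{\boldsymbol{\beta}}|\,\|\mathcal{H}_{W}^{-1}\mathbf{W}_{j}\|}\quad\text{or}\quad\pi_{i}^{mV_{c}}=\frac{|y_{i}-\mathbf{W}_{i}^{T}\hat{\boldsymbol{\beta}}|\,\|\mathbf{W}_{i}\|}{\sum_{j=1}^{n}|y_{j}-\mathbf{W}_{j}^{T}\hat{\boldsymbol{\beta}}|\,\|\mathbf{W}_{j}\|}.$$ Step 2: draw a subsample of size $r$ with replacement with probabilities $\pi_i(\tilde{\boldsymbol{\beta}}_0)$. Combine the $r_0+r$ sampled points of the two steps (with attached probabilities $1/n$ for the first-step points and $\pi_i(\tilde{\boldsymbol{\beta}}_0)$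 for the second-step points); $\breve{\boldsymbol{\beta}}$ is the weighted subsample estimator with $s=r_0+r$ based on the combined sample. *)

(* Defs.v *)
(* MathComp / MathComp-Analysis *)
From HB Require Import structures.
From mathcomp Require Import all_boot all_order all_algebra.
From mathcomp Require Import all_classical all_reals all_analysis.
Set Implicit Arguments.
Unset Strict Implicit.
Unset Printing Implicit Defensive.
Import Order.TTheory GRing.Theory Num.Theory.
Import numFieldNormedType.Exports.
Local Open Scope classical_set_scope.
Local Open Scope ring_scope.

Section LinearAlgebra.
Context {R : realType} {p : nat}.
Implicit Types (u v b : 'cV[R]_p) (A : 'M[R]_p).

Definition dotv u v : R := (u^T *m v) 0 0.

(* The library norm on matrices is the sup norm, hence this one. *)
Definition enorm v : R := Num.sqrt (dotv v v).

Definition posdef A : Prop :=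
  A^T = A /\ forall v, v != 0 -> 0 < dotv v (A *m v).

(* "The" minimizer: estimators defined as an argmin exist when the minimizer
   exists and is unique. *)
Definition is_argmin (f : 'cV[R]_p -> R) b : Prop :=
  forall c, c != b -> f b < f c.

Definition argmin_exists (f : 'cV[R]_p -> R) : Prop := exists b, is_argmin f b.

(* Junk value 0 when there is no unique minimizer. *)
Definition argmin (f : 'cV[R]_p -> R) : 'cV[R]_p := xget 0 (is_argmin f).

End LinearAlgebra.

(* mV: minimizes the trace of the asymptotic covariance matrix;
   mVc: the variant without the inverse of H_W. *)
Inductive criterion := mV | mVc.

(* Everything in this section is a deterministic function of a realization
   (w_i, y_i), i < n, of the full data F_n. *)
Section Estimators.
Context {R : realType} {p : nat} (Suu : 'M[R]_p).

Definition HW n (w : 'I_n -> 'cV[R]_p) : 'M[R]_p :=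
  n%:R^-1 *: (\sum_(i < n) w i *m (w i)^T) - Suu.

Definition full_loss n (w : 'I_n -> 'cV[R]_p) (y : 'I_n -> R)
    (b : 'cV[R]_p) : R :=
  (2 * n%:R)^-1 * (\sum_(i < n) (y i - dotv (w i) b) ^+ 2)
  - 2^-1 * dotv b (Suu *m b).

Definition beta_hat n (w : 'I_n -> 'cV[R]_p) (y : 'I_n -> R) : 'cV[R]_p :=
  argmin (full_loss w y).

(* n is the full-data size, s the subsample size, and (ws j, ys j, pis j) are
   the sampled points with their attached probabilities. *)
Definition weighted_loss (n s : nat) (ws : 'I_s -> 'cV[R]_p) (ys : 'I_s -> R)
    (pis : 'I_s -> R) (b : 'cV[R]_p) : R :=
  (2 * n%:R)^-1 *
    (\sum_(j < s) (s%:R * pis j)^-1 * (ys j - dotv (ws j) b) ^+ 2)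
  - 2^-1 * dotv b (Suu *m b).

Section Data.
Context {n : nat} (w : 'I_n -> 'cV[R]_p) (y : 'I_n -> R).
Variable crit : criterion.

Definition score (b : 'cV[R]_p) (i : 'I_n) : R :=
  `|y i - dotv (w i) b| *
  enorm (match crit with mV => invmx (HW w) *m w i | mVc => w i end).

(* If all scores vanish the scheme is undefined; here all the probabilities
   are then 0, so that max_inv_prob below is +oo. *)
Definition sub_prob (b : 'cV[R]_p) (i : 'I_n) : R :=
  score b i / \sum_(j < n) score b j.

(* The inverse is that of the extended reals, where 0^-1 = +oo. *)
Definition max_inv_prob (b : 'cV[R]_p) : \bar R :=
  (\big[maxe/-oo]_(i < n) ((n%:R * sub_prob b i)%:E)^-1)%E.

Section TwoStep.
Context {r0 r : nat}.
(* k and l list the indices drawn in the first and in the second step *)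
Implicit Types (k : {ffun 'I_r0 -> 'I_n}) (l : {ffun 'I_r -> 'I_n}).

Definition pilot_loss k : 'cV[R]_p -> R :=
  weighted_loss n (fun j => w (k j)) (fun j => y (k j)) (fun=> n%:R^-1).

Definition pilot_exists k : Prop := argmin_exists (pilot_loss k).

Definition pilot k : 'cV[R]_p := argmin (pilot_loss k).

Definition comb_idx k l (j : 'I_(r0 + r)) : 'I_n :=
  match fintype.split j with inl a => k a | inr a => l a end.

Definition comb_prob k l (j : 'I_(r0 + r)) : R :=
  match fintype.split j with
  | inl _ => n%:R^-1
  | inr a => sub_prob (pilot k) (l a)
  end.

Definition comb_loss k l : 'cV[R]_p -> R :=
  weighted_loss n (fun j => w (comb_idx k l j)) (fun j => y (comb_idx k l j))
    (comb_prob k l).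

(* Conditional probability, given the full data, of an event depending on the
   two draws: first k uniform with replacement, then, given k, l with
   replacement according to sub_prob (pilot k). *)
Definition cond_prob (E : {ffun 'I_r0 -> 'I_n} -> {ffun 'I_r -> 'I_n} -> Prop)
    : R :=
  \sum_(k : {ffun 'I_r0 -> 'I_n}) \sum_(l : {ffun 'I_r -> 'I_n})
    (n%:R^-1) ^+ r0 * (\prod_(j < r) sub_prob (pilot k) (l j)) *
    (`[< E k l >])%:R.

(* The pilot exists, but the two-step estimator does not, or it does and is at
   distance at least t from beta_hat. *)
Definition far_event (t : R) k l : Prop :=
  pilot_exists k /\
  (~ argmin_exists (comb_loss k l) \/
   t <= enorm (argmin (comb_loss k l) - beta_hat w y)).

End TwoStep.
End Data.
End Estimators.

Section Probability.
Context {R : realType} {d : measure_display} {T : measurableType d}.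
Variable P : probability T R.

(* The outer probability P^* agrees with P on measurable events; it avoids
   the arbitrary values of P on sets not known to be measurable. *)
Definition prob (A : set T) : \bar R := mu_ext P A.

Definition cvg_in_prob (Z : nat -> T -> R) (a : R) : Prop :=
  forall e : R, 0 < e ->
    (fun n => prob [set t | e <= `|Z n t - a|]) @ \oo --> 0%E.

Definition bounded_in_prob (Z : nat -> T -> R) : Prop :=
  forall delta : R, 0 < delta ->
    exists C : R, \forall n \near \oo,
      (prob [set t | (C < `|Z n t|)%R] <= delta%:E)%E.

(* Probability of an event depending on both the data and r0 independent
   uniform draws k from the n indices, the draws being independent of the
   data. *)
Definition joint_prob (n r0 : nat) (E : {ffun 'I_r0 -> 'I_n} -> set T)
    : \bar R :=
  (\sum_(k : {ffun 'I_r0 -> 'I_n}) ((n%:R^-1) ^+ r0)%:E * prob (E k))%E.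

Definition independent_sigma (F G : set (set T)) : Prop :=
  forall A B, F A -> G B -> P (A `&` B) = (P A * P B)%E.

Section Model.
Context {p : nat}.
Variables (beta : 'cV[R]_p) (Suu : 'M[R]_p) (sigma : R).
Variables (X U : nat -> 'I_p -> {RV P >-> R}) (eps : nat -> {RV P >-> R}).

Definition errors_in_variables_model : Prop :=
  forall i : nat,
    [/\ (eps i : T -> R) \in Lfun P 2%:E,
        ('E_P[eps i] = 0)%E,
        ('V_P[eps i] = (sigma ^+ 2)%:E)%E,
        (forall a : 'I_p, (U i a : T -> R) \in Lfun P 2%:E /\
           ('E_P[U i a] = 0)%E) &
        (forall a b : 'I_p, covariance P (U i a) (U i b) = (Suu a b)%:E)] /\
    independent_sigma
      (g_sigma_preimage (fun a => U i a : T -> R))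
      <<s g_sigma_algebra_preimage (eps i : T -> R) `|`
          g_sigma_preimage (fun a => X i a : T -> R) >>.

Definition Xvec (i : nat) (t : T) : 'cV[R]_p := \col_a X i a t.

Definition W (n : nat) (t : T) (i : 'I_n) : 'cV[R]_p :=
  Xvec i t + \col_a U i a t.

Definition Y (n : nat) (t : T) (i : 'I_n) : R :=
  dotv (Xvec i t) beta + eps i t.

End Model.
End Probability.

(* Main.v *)
From Pilot Require Import Defs.
From HB Require Import structures.
From mathcomp Require Import all_boot all_order all_algebra.
From mathcomp Require Import all_classical all_reals all_analysis.
From mathcomp Require Import measurable_realfun ring lra.
Import Order.TTheory GRing.Theory Num.Theory.
Import numFieldNormedType.Exports.
Local Open Scope classical_set_scope.
Local Open Scope ring_scope.

(** Conditionally on the data, both the full-data criterion and the criterion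
    of the combined subsample are quadratic functions of the parameter.  With
    H the Hessian (gram matrix minus Suu) and s the negative gradient, such a
    function has its unique minimizer where s vanishes as soon as H is
    coercive, v . (H v) >= lam |v|^2, and then every b0 lies within
    |s(b0)| / lam of this minimizer ([corrected_argmin]).  Taking for b0 the
    full-data estimator, it remains to bound from below the Hessian and to
    bound from above the gradient of the subsample criterion there.

    Every entry of the subsample Hessian, and of the subsample gradient at the
    full-data estimator, differs from its full-data counterpart (which is 0
    for the gradient) by the error of an inverse-probability weighted mean of
    some x_i: x_i = w_ia w_ib for the Hessian, x_i = (residual i) w_ia for the
    gradient.  Both sampling steps give unbiased means: the first because
    its attached probability 1/n is the true one, the second because, given
    the pilot, it is reweighted by its own probabilities.  The error is thus a
    sum of centered terms, independent given the pilot, whose second moment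
    is at most 2 (1 + C) (mean of x_i^2) / r once all 1/(n pi_i) are at most C
    ([reweighted_mean_second_moment]).  The fourth moment assumptions bound
    the mean of x_i^2, and Chebyshev gives the rate sqrt r
    ([cond_prob_far_le]).

    This is a bound for fixed data.  It applies outside of an event of small
    probability: there the Hessian is entrywise close to its positive
    definite limit, hence coercive ([posdef_coercive], [coercive_entrywise]);
    the fourth moments are bounded; and the proportion of pilot draws with a
    large 1/(n pi_i) is below epsilon / 2.  The last point transfers the bound
    on max 1/(n pi_i), which is assumed for the data and the pilot draw
    jointly, to almost all data by Markov's inequality.  As the events need
    not be measurable, it is proved for outer probabilities
    ([outer_markov]). *)

Set Implicit Arguments.
Unset Strict Implicit.
Unset Printing Implicit Defensive.

(** * Coercive matrices *)

Section EuclideanGeometry.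
Context {R : realType} {p : nat}.
Implicit Types (u v b : 'cV[R]_p) (A H : 'M[R]_p).

Lemma dotvE u v : dotv u v = \sum_a u a 0 * v a 0.
Proof. by rewrite /dotv mxE; apply: eq_bigr => a _; rewrite mxE. Qed.

Lemma dotvDr u v b : dotv u (v + b) = dotv u v + dotv u b.
Proof. by rewrite /dotv mulmxDr mxE. Qed.

Lemma dotvZr c u v : dotv u (c *: v) = c * dotv u v.
Proof. by rewrite /dotv -scalemxAr mxE. Qed.

Lemma dotvNr u v : dotv u (- v) = - dotv u v.
Proof. by rewrite -scaleN1r dotvZr mulN1r. Qed.

Lemma dotv0r u : dotv u 0 = 0.
Proof. by rewrite /dotv mulmx0 mxE. Qed.

Lemma dotvC u v : dotv u v = dotv v u.
Proof. by rewrite !dotvE; apply: eq_bigr => a _; rewrite mulrC. Qed.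

Lemma dotvDl u v b : dotv (u + v) b = dotv u b + dotv v b.
Proof. by rewrite dotvC dotvDr !(dotvC b). Qed.

Lemma dotvZl c u v : dotv (c *: u) v = c * dotv u v.
Proof. by rewrite dotvC dotvZr dotvC. Qed.

Lemma dotv_sumr (J : finType) u (v : J -> 'cV[R]_p) :
  dotv u (\sum_j v j) = \sum_j dotv u (v j).
Proof. by rewrite /dotv mulmx_sumr summxE. Qed.

Lemma dotv_trmx A u v : dotv u (A *m v) = dotv (A^T *m u) v.
Proof. by rewrite /dotv trmx_mul trmxK mulmxA. Qed.

Lemma dotv_ge0 u : 0 <= dotv u u.
Proof. by rewrite dotvE sumr_ge0 // => a _; rewrite -expr2 sqr_ge0. Qed.

Lemma sqr_entry_le_dotv u a : u a 0 ^+ 2 <= dotv u u.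
Proof.
rewrite dotvE (bigD1 a) //= -expr2 lerDl sumr_ge0 // => i _.
by rewrite -expr2 sqr_ge0.
Qed.

Lemma dotv_gt0 u : u != 0 -> 0 < dotv u u.
Proof.
move=> u0; rewrite lt_def dotv_ge0 andbT; apply: contraNN u0 => /eqP uu.
apply/eqP/colP => a; rewrite mxE; apply/eqP; rewrite -sqrf_eq0 eq_le sqr_ge0.
by rewrite andbT -uu sqr_entry_le_dotv.
Qed.

Lemma sqr_enorm u : enorm u ^+ 2 = dotv u u.
Proof. by rewrite /enorm sqr_sqrtr ?dotv_ge0. Qed.

Lemma dotv_mulmxE u A v :
  dotv u (A *m v) = \sum_a \sum_b A a b * (u a 0 * v b 0).
Proof.
rewrite dotvE; apply: eq_bigr => a _; rewrite mxE mulr_sumr.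
by apply: eq_bigr => b _; rewrite mulrCA.
Qed.

(** |v_a v_b| <= (v_a^2 + v_b^2) / 2 <= v . v bounds the quadratic form by the
    sum of the entries, which is all that entrywise convergence controls. *)
Lemma dotv_mulmx_le A v :
  `|dotv v (A *m v)| <= (\sum_a \sum_b `|A a b|) * dotv v v.
Proof.
rewrite dotv_mulmxE mulr_suml (le_trans (ler_norm_sum _ _ _))//.
apply: ler_sum => a _; rewrite mulr_suml (le_trans (ler_norm_sum _ _ _))//.
apply: ler_sum => b _; rewrite normrM ler_wpM2l // ler_norml.
have := sqr_entry_le_dotv v a; have := sqr_entry_le_dotv v b => hb ha.
have := sqr_ge0 (v a 0 - v b 0); have := sqr_ge0 (v a 0 + v b 0).
by rewrite sqrrB sqrrD => h1 h2; apply/andP; split; lra.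
Qed.

Definition coercive (lam : R) A : Prop :=
  forall v, lam * dotv v v <= dotv v (A *m v).

Lemma coercive_perturbation lam mu A H :
  (\sum_a \sum_b `|A a b - H a b| <= mu) -> coercive lam H ->
  coercive (lam - mu) A.
Proof.
move=> AH cH v; have -> : A = (A - H) + H by rewrite subrK.
rewrite mulmxDl dotvDr mulrBl.
have /ler_normlP[h _] := dotv_mulmx_le (A - H) v.
have AH' : \sum_a \sum_b `|(A - H) a b| <= mu.
  by under eq_bigr => a _ do under eq_bigr => b _ do rewrite !mxE.
have := ler_wpM2r (dotv_ge0 v) AH'; have := cH v; lra.
Qed.

(** The successor in (p * p).+1 keeps the denominator nonzero when p = 0. *)
Lemma coercive_entrywise lam A H : 0 < lam -> coercive lam H ->
  (forall i j, `|A i j - H i j| <= lam / (2 * (p * p).+1%:R)) ->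
  coercive (lam / 2) A.
Proof.
move=> lam0 cH; set t := lam / _ => AH.
have -> : lam / 2 = lam - lam / 2 by lra.
apply: (coercive_perturbation _ cH).
apply: (@le_trans _ _ (\sum_(a < p) \sum_(b < p) t)).
  by apply: ler_sum => a _; apply: ler_sum => b _.
rewrite !sumr_const !card_ord -mulrnA -[t *+ _]mulr_natr.
have -> : lam / 2 = t * (p * p).+1%:R.
  by rewrite /t invfM mulrA -[RHS]mulrA mulVf ?mulr1 // pnatr_eq0.
by rewrite ler_wpM2l ?ler_nat // divr_ge0 ?(ltW lam0) // mulr_ge0.
Qed.

Lemma coercive_unitmx lam A : 0 < lam -> coercive lam A -> A \in unitmx.
Proof.
move=> lam0 cA; rewrite -unitmx_tr -row_free_unit -kermx_eq0.
apply/eqP/row_matrixP => i; rewrite row0.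
set u := row i _; have uA : u *m A^T = 0.
  by apply/sub_kermxP; exact: row_sub.
apply: trmx_inj; rewrite trmx0; apply/eqP; apply: contraT => u0.
have := cA u^T; rewrite -[A]trmxK -trmx_mul uA trmx0.
rewrite dotv0r leNgt mulr_gt0 //; exact: dotv_gt0.
Qed.

Lemma posdef_unitmx H : posdef H -> H \in unitmx.
Proof.
move=> [Hsym Hpos]; rewrite -row_free_unit -kermx_eq0.
apply/eqP/row_matrixP => i; rewrite row0.
set u := row i _; have uH : u *m H = 0.
  by apply/sub_kermxP; exact: row_sub.
apply: trmx_inj; rewrite trmx0; apply/eqP; apply: contraT => u0.
have := Hpos _ u0; rewrite -{1}Hsym -trmx_mul uH trmx0.
by rewrite dotv0r ltxx.
Qed.

(** The quadratic form is nonnegative at u - t v for the optimal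
    t = (u . H v) / (v . H v). *)
Lemma posdef_Cauchy_Schwarz H u v : posdef H ->
  dotv u (H *m v) ^+ 2 <= dotv u (H *m u) * dotv v (H *m v).
Proof.
move=> [Hsym Hpos]; have [->|v0] := eqVneq v 0.
  by rewrite mulmx0 !dotv0r expr0n mulr0.
have Hge0 b : 0 <= dotv b (H *m b).
  have [->|/Hpos/ltW//] := eqVneq b 0; by rewrite mulmx0 dotv0r.
have vv := Hpos v v0.
set t := dotv u (H *m v) / dotv v (H *m v).
have := Hge0 (u + (- t) *: v).
rewrite mulmxDr -scalemxAr !(dotvDr, dotvDl, dotvZr, dotvZl).
have -> : dotv v (H *m u) = dotv u (H *m v).
  by rewrite dotv_trmx Hsym dotvC.
rewrite -(ler_pdivrMr _ _ vv); set q := dotv u (H *m v).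
have -> : q ^+ 2 / dotv v (H *m v) = t * q by rewrite /t -/q expr2 mulrAC.
have : t * dotv v (H *m v) = q by rewrite /t divfK // gt_eqF.
move=> tv; rewrite !mulNr mulrN opprK tv; lra.
Qed.

(** A lower bound on the spectrum without eigenvalues or compactness: applying
    Cauchy-Schwarz for the form H to v and H^-1 v gives
    |v|^4 <= (v . H v) (v . H^-1 v) <= (v . H v) K |v|^2,
    with K above the sum of the absolute entries of H^-1. *)
Lemma posdef_coercive H : posdef H ->
  exists2 lam, 0 < lam & coercive lam H.
Proof.
move=> Hpd; set K := 1 + \sum_a \sum_b `|invmx H a b|.
have K0 : 0 < K.
  by rewrite ltr_wpDr // sumr_ge0 // => a _; rewrite sumr_ge0.
exists K^-1; first by rewrite invr_gt0.
move=> v; rewrite mulrC ler_pdivrMr //.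
have [->|v0] := eqVneq v 0; first by rewrite mulmx0 !dotv0r mul0r.
have vv := dotv_gt0 v0.
have := posdef_Cauchy_Schwarz v (invmx H *m v) Hpd.
rewrite mulKVmx ?posdef_unitmx // (dotvC (invmx H *m v)) => CS.
have h := le_trans (ler_norm _) (dotv_mulmx_le (invmx H) v).
have Hv : 0 <= dotv v (H *m v) by rewrite ltW //; apply: (proj2 Hpd).
rewrite -(ler_pM2r vv) -expr2 (le_trans CS)// -mulrA ler_wpM2l //.
by rewrite (le_trans h)// ler_wpM2r ?ltW // ltrDr.
Qed.

End EuclideanGeometry.

(** * Least squares corrected for measurement errors *)

Section CorrectedLeastSquares.
Context {R : realType} {p : nat} (Suu : 'M[R]_p) (c : R).
Context {J : finType} (om : J -> R) (ws : J -> 'cV[R]_p) (ys : J -> R).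
Hypothesis Suu_sym : Suu^T = Suu.
Implicit Types (b h : 'cV[R]_p).

(** Common form of the full-data criterion (c = 1/n, om = 1) and of the
    subsample criteria (om_j the inverse of s pi_j). *)
Definition corrected_loss b : R :=
  2^-1 * (c * \sum_j om j * (ys j - dotv (ws j) b) ^+ 2)
  - 2^-1 * dotv b (Suu *m b).

Definition corrected_gram : 'M[R]_p :=
  c *: (\sum_j om j *: (ws j *m (ws j)^T)) - Suu.

(** The negative gradient of the loss, for symmetric Suu. *)
Definition corrected_score b : 'cV[R]_p :=
  c *: (\sum_j (om j * (ys j - dotv (ws j) b)) *: ws j) + Suu *m b.

Lemma mul_corrected_gram h : corrected_gram *m h =
  c *: (\sum_j (om j * dotv (ws j) h) *: ws j) - Suu *m h.
Proof.
rewrite /corrected_gram mulmxBl -scalemxAl mulmx_suml.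
congr (c *: _ - _); apply: eq_bigr => j _.
rewrite -scalemxAl -mulmxA [_^T *m h]mx11_scalar mul_mx_scalar scalerA.
by rewrite mulrC.
Qed.

Lemma corrected_scoreD b h :
  corrected_score (b + h) = corrected_score b - corrected_gram *m h.
Proof.
rewrite /corrected_score mul_corrected_gram.
under eq_bigr => j _ do rewrite dotvDr opprD addrA mulrBr scalerBl.
rewrite sumrB scalerBr mulmxDr opprB -!addrA; congr (_ + _).
by rewrite addrC -addrA.
Qed.

Lemma corrected_lossD b h :
  corrected_loss (b + h) = corrected_loss b - dotv h (corrected_score b)
    + 2^-1 * dotv h (corrected_gram *m h).
Proof.
rewrite /corrected_loss /corrected_score mul_corrected_gram.
rewrite mulmxDr !(dotvDr, dotvDl) dotvNr !dotvZr !dotv_sumr.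
rewrite (_ : dotv h (Suu *m b) = dotv b (Suu *m h)); last first.
  by rewrite dotv_trmx Suu_sym dotvC.
under eq_bigr => j _ do rewrite dotvDr.
have -> : \sum_j om j * (ys j - (dotv (ws j) b + dotv (ws j) h)) ^+ 2 =
  \sum_j om j * (ys j - dotv (ws j) b) ^+ 2
  - 2 * (\sum_j dotv h ((om j * (ys j - dotv (ws j) b)) *: ws j))
  + \sum_j dotv h ((om j * dotv (ws j) h) *: ws j).
  rewrite mulr_sumr -sumrB -big_split; apply: eq_bigr => j _ /=.
  by rewrite !dotvZr (dotvC h); ring.
by field.
Qed.

(** The minimizer is b0 + h with h = gram^-1 score(b0), by the two expansions
    above.  Since gram h = score(b0), coercivity gives
    lam |h|^2 <= h . score(b0), whence the bound on h by completing the square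
    |score(b0) - lam h|^2 >= 0. *)
Lemma corrected_argmin b0 lam : 0 < lam -> coercive lam corrected_gram ->
  exists b, [/\ is_argmin corrected_loss b, corrected_score b = 0 &
    lam ^+ 2 * dotv (b - b0) (b - b0) <=
      dotv (corrected_score b0) (corrected_score b0)].
Proof.
move=> lam0 cA; have uA := coercive_unitmx lam0 cA.
set h := invmx corrected_gram *m corrected_score b0.
have Ah : corrected_gram *m h = corrected_score b0 by rewrite /h mulKVmx.
exists (b0 + h); have s0 : corrected_score (b0 + h) = 0.
  by rewrite corrected_scoreD Ah subrr.
split => //.
- move=> b' bb'; rewrite -[b'](subrKC (b0 + h)) (corrected_lossD (b0 + h)) s0.
  have d0 : b' - (b0 + h) != 0 by rewrite subr_eq0.
  have := cA (b' - (b0 + h)); have := mulr_gt0 lam0 (dotv_gt0 d0).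
  by rewrite dotv0r; lra.
- have -> : b0 + h - b0 = h by rewrite addrC addKr.
  have := cA h; rewrite Ah => ch.
  move: h (corrected_score b0) ch {s0 Ah} => h s ch.
  have := dotv_ge0 (s + (- lam) *: h).
  rewrite !(dotvDr, dotvDl, dotvZr, dotvZl) (dotvC s h).
  by have := ler_wpM2l (ltW lam0) ch; lra.
Qed.

End CorrectedLeastSquares.

Lemma argminE {R : realType} {p : nat} (f : 'cV[R]_p -> R) b :
  is_argmin f b -> argmin f = b.
Proof.
move=> fb; rewrite /argmin; case: xgetP => [b' _ fb'|/(_ b)//].
apply/eqP; apply: contraT => bb'; have := fb _ bb'.
by rewrite eq_sym in bb'; have := fb' _ bb'; move=> /lt_trans h/h; rewrite ltxx.
Qed.

(** * Moments of weighted means of draws with replacement *)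

Section SamplingWithReplacement.
Context {R : realType} {n r : nat} (q z : 'I_n -> R).

Lemma sum_draws : \sum_(l : {ffun 'I_r -> 'I_n}) \prod_(j < r) q (l j) =
  (\sum_i q i) ^+ r.
Proof.
by rewrite -(bigA_distr_bigA (fun (_ : 'I_r) i => q i)) prodr_const card_ord.
Qed.

(** Independence of the draws: the expectation of a product over the draws
    factorizes, and each factor other than j and j' is the total mass 1. *)
Lemma draws_cross_moment (j j' : 'I_r) : \sum_i q i = 1 ->
  \sum_i q i * z i = 0 ->
  \sum_(l : {ffun 'I_r -> 'I_n}) (\prod_(a < r) q (l a)) * (z (l j) * z (l j'))
  = if j == j' then \sum_i q i * z i ^+ 2 else 0.
Proof.
move=> q1 qz0.
pose F (a : 'I_r) i := q i * ((if a == j then z i else 1) *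
  (if a == j' then z i else 1)).
have -> : \sum_(l : {ffun 'I_r -> 'I_n})
    (\prod_(a < r) q (l a)) * (z (l j) * z (l j'))
  = \sum_(l : {ffun 'I_r -> 'I_n}) \prod_(a < r) F a (l a).
  apply: eq_bigr => l _; rewrite /F !big_split /=; congr (_ * (_ * _)).
  - by rewrite -big_mkcond big_pred1_eq.
  - by rewrite -big_mkcond big_pred1_eq.
rewrite -bigA_distr_bigA (bigD1 j) //=.
have [jj'|jj'] := eqVneq j j'; last first.
  rewrite (_ : \sum_i F j i = 0) ?mul0r // -[RHS]qz0; apply: eq_bigr => i _.
  by rewrite /F eqxx (negPf jj') mulr1.
have -> : \prod_(a < r | a != j) \sum_i F a i = 1.
  apply: big1 => a aj; rewrite -[RHS]q1; apply: eq_bigr => i _.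
  by rewrite /F -jj' (negPf aj) !mulr1.
by rewrite mulr1; apply: eq_bigr => i _; rewrite /F -jj' eqxx expr2.
Qed.

Lemma draws_second_moment : \sum_i q i = 1 -> \sum_i q i * z i = 0 ->
  \sum_(l : {ffun 'I_r -> 'I_n})
    (\prod_(j < r) q (l j)) * (\sum_(j < r) z (l j)) ^+ 2
  = r%:R * \sum_i q i * z i ^+ 2.
Proof.
move=> q1 qz0.
under eq_bigr => l _.
  rewrite expr2 mulr_suml mulr_sumr.
  under eq_bigr => j _ do rewrite mulr_sumr mulr_sumr.
  over.
rewrite exchange_big /= -[r in RHS]card_ord mulr_natl -sumr_const.
apply: eq_bigr => j _; rewrite exchange_big /=.
under eq_bigr => j' _ do rewrite draws_cross_moment //.
by rewrite -big_mkcond (big_pred1 j) // => j'; rewrite eq_sym.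
Qed.

End SamplingWithReplacement.

Section ReweightedMean.
Context {R : realType} {p n : nat} (Suu : 'M[R]_p).
Context (w : 'I_n -> 'cV[R]_p) (y : 'I_n -> R) (crit : criterion).
Context {r0 r : nat} (x : 'I_n -> R).
Implicit Types (k : {ffun 'I_r0 -> 'I_n}) (l : {ffun 'I_r -> 'I_n}).
Hypotheses (n_gt0 : (0 < n)%N) (r_gt0 : (0 < r)%N).

Definition mean : R := n%:R^-1 * \sum_i x i.

Definition mean_sqr : R := n%:R^-1 * \sum_i x i ^+ 2.

Definition reweighted_mean k l : R :=
  n%:R^-1 * \sum_(j < r0 + r)
    ((r0 + r)%:R * comb_prob Suu w y crit k l j)^-1 * x (comb_idx k l j).

Let nR_gt0 : 0 < n%:R :> R. Proof. by rewrite ltr0n. Qed.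

Let nR_neq0 : n%:R != 0 :> R. Proof. by rewrite gt_eqF. Qed.

Let s_gt0 : 0 < (r0 + r)%:R :> R.
Proof. by rewrite ltr0n addn_gt0 r_gt0 orbT. Qed.

Lemma mean_sqr_ge0 : 0 <= mean_sqr.
Proof.
rewrite mulr_ge0 ?invr_ge0 ?ler0n ?sumr_ge0 // => i _.
exact: sqr_ge0.
Qed.

(** The attached probability of a pilot point is 1/n, so its weight n cancels
    the normalization by n. *)
Lemma reweighted_mean_dev k l : reweighted_mean k l - mean =
  (r0 + r)%:R^-1 * (\sum_(j < r0) (x (k j) - mean) +
    \sum_(j < r)
      (x (l j) / (n%:R * sub_prob Suu w y crit (pilot Suu w y k) (l j))
       - mean)).
Proof.
rewrite !sumrB !sumr_const !card_ord addrACA -opprD -mulrnDr mulrBr.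
congr (_ - _); last by rewrite -[mean *+ _]mulr_natl mulKf // gt_eqF.
rewrite /reweighted_mean big_split_ord /= mulrDr [RHS]mulrDr !mulr_sumr.
congr (_ + _); apply: eq_bigr => j _; rewrite /comb_prob /comb_idx.
  rewrite (unsplitK (inl j : 'I_r0 + 'I_r)) mulrA; congr (_ * _).
  by rewrite invfM invrK mulrCA mulVf // mulr1.
rewrite (unsplitK (inr j : 'I_r0 + 'I_r)) !invfM; ring.
Qed.

Lemma centered_second_moment (q v : 'I_n -> R) m : \sum_i q i = 1 ->
  \sum_i q i * v i = m ->
  \sum_i q i * (v i - m) ^+ 2 <= \sum_i q i * v i ^+ 2.
Proof.
move=> q1 qv; have -> : \sum_i q i * (v i - m) ^+ 2 =
    \sum_i q i * v i ^+ 2 - 2 * m * (\sum_i q i * v i) + m ^+ 2 * \sum_i q i.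
  rewrite !mulr_sumr -sumrB -big_split; apply: eq_bigr => i _ /=; ring.
by rewrite q1 qv; have := sqr_ge0 m; lra.
Qed.

Lemma pilot_draws_second_moment :
  \sum_(k : {ffun 'I_r0 -> 'I_n})
    n%:R^-1 ^+ r0 * (\sum_(j < r0) (x (k j) - mean)) ^+ 2
  <= r0%:R * mean_sqr.
Proof.
have u1 : \sum_(i < n) (n%:R^-1 : R) = 1.
  by rewrite sumr_const card_ord -[LHS]mulr_natl mulfV.
have um : \sum_i n%:R^-1 * x i = mean by rewrite -mulr_sumr.
have um0 : \sum_i n%:R^-1 * (x i - mean) = 0.
  under eq_bigr do rewrite mulrBr.
  by rewrite sumrB um -mulr_suml u1 mul1r subrr.
under eq_bigr do rewrite -[r0 in _ ^+ r0]card_ord -prodr_const.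
rewrite (draws_second_moment u1 um0).
rewrite ler_wpM2l ?ler0n // (le_trans (centered_second_moment u1 um)) //.
by rewrite -mulr_sumr.
Qed.

(** One factor 1/(n q_i) of the square is absorbed by the bound C; the other
    one cancels against the sampling probability q_i. *)
Lemma second_draws_second_moment (q : 'I_n -> R) C : 0 <= C ->
  \sum_i q i = 1 -> (forall i, 0 < q i) -> (forall i, (n%:R * q i)^-1 <= C) ->
  \sum_(l : {ffun 'I_r -> 'I_n}) (\prod_(j < r) q (l j)) *
    (\sum_(j < r) (x (l j) / (n%:R * q (l j)) - mean)) ^+ 2
  <= r%:R * (C * mean_sqr).
Proof.
move=> C0 q1 q0 qC.
have qm : \sum_i q i * (x i / (n%:R * q i)) = mean.
  rewrite /mean mulr_sumr; apply: eq_bigr => i _.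
  rewrite invfM mulrCA [_ / q i]mulrC mulrA.
  have := q0 i => /gt_eqF/negbT qi.
  by field; rewrite qi nR_neq0.
rewrite (@draws_second_moment _ _ _ _
  (fun i => x i / (n%:R * q i) - mean)) //; last first.
  under eq_bigr do rewrite mulrBr.
  by rewrite sumrB qm -mulr_suml q1 mul1r subrr.
rewrite ler_wpM2l ?ler0n // (le_trans (centered_second_moment q1 qm)) //.
rewrite /mean_sqr !mulr_sumr; apply: ler_sum => i _.
have /gt_eqF/negbT qi := q0 i.
have -> : q i * (x i / (n%:R * q i)) ^+ 2 =
    (n%:R * q i)^-1 * (n%:R^-1 * x i ^+ 2) by field; rewrite qi nR_neq0.
rewrite ler_wpM2r ?qC //.
by rewrite mulr_ge0 ?sqr_ge0 // invr_ge0 ltW.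
Qed.

(** The sum over k is restricted to good pilot draws because the second-step
    probabilities depend on k and may be arbitrarily small elsewhere.  The
    pilot part contributes r0 and the second part r C to the variance, so the
    total is at most (r0 + r) (1 + C), to be divided by (r0 + r)^2; the factor
    2 comes from (u + v)^2 <= 2 u^2 + 2 v^2. *)
Lemma reweighted_mean_second_moment (good : pred {ffun 'I_r0 -> 'I_n}) C :
  0 <= C ->
  (forall k, good k -> let q := sub_prob Suu w y crit (pilot Suu w y k) in
     [/\ \sum_i q i = 1, forall i, 0 < q i & forall i, (n%:R * q i)^-1 <= C]) ->
  \sum_(k : {ffun 'I_r0 -> 'I_n} | good k)
    \sum_(l : {ffun 'I_r -> 'I_n}) n%:R^-1 ^+ r0 *
     (\prod_(j < r) sub_prob Suu w y crit (pilot Suu w y k) (l j)) *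
     (reweighted_mean k l - mean) ^+ 2
  <= 2 * (1 + C) * mean_sqr / r%:R.
Proof.
move=> C0 goodP; set s : R := (r0 + r)%:R.
have m0 := mean_sqr_ge0.
have c0 : 0 <= 2 * s^-1 ^+ 2 by apply: mulr_ge0 => //; exact: sqr_ge0.
pose Sk k := \sum_(j < r0) (x (k j) - mean).
have step k : good k -> \sum_(l : {ffun 'I_r -> 'I_n}) n%:R^-1 ^+ r0 *
     (\prod_(j < r) sub_prob Suu w y crit (pilot Suu w y k) (l j)) *
     (reweighted_mean k l - mean) ^+ 2
   <= n%:R^-1 ^+ r0 * (2 * s^-1 ^+ 2 * (Sk k ^+ 2 + r%:R * (C * mean_sqr))).
  move=> /goodP; set q := sub_prob _ _ _ _ _ => -[q1 q0 qC].
  under eq_bigr do rewrite -mulrA.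
  rewrite -mulr_sumr ler_wpM2l ?exprn_ge0 ?invr_ge0 ?ler0n //.
  pose Sl l := \sum_(j < r) (x (l j) / (n%:R * q (l j)) - mean).
  pose Q (l : {ffun 'I_r -> 'I_n}) := \prod_(j < r) q (l j).
  apply: (@le_trans _ _ (\sum_(l : {ffun 'I_r -> 'I_n}) Q l *
    (2 * s^-1 ^+ 2 * (Sk k ^+ 2 + Sl l ^+ 2)))).
    apply: ler_sum => l _; rewrite ler_wpM2l ?prodr_ge0 // => [j _|].
      exact: ltW.
    rewrite reweighted_mean_dev -/q -/(Sk k) -/(Sl l) exprMn -/s.
    rewrite [2 * _]mulrC -[leRHS]mulrA ler_wpM2l ?sqr_ge0 //.
    by have := sqr_ge0 (Sk k - Sl l); rewrite sqrrB sqrrD; lra.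
  under eq_bigr do rewrite mulrCA mulrDr.
  rewrite -mulr_sumr big_split /= -mulr_suml sum_draws q1 expr1n mul1r.
  rewrite ler_wpM2l // lerD2l.
  exact: second_draws_second_moment.
apply: (le_trans (ler_sum _ step)).
apply: (@le_trans _ _ (\sum_(k : {ffun 'I_r0 -> 'I_n}) n%:R^-1 ^+ r0 *
    (2 * s^-1 ^+ 2 * (Sk k ^+ 2 + r%:R * (C * mean_sqr))))).
  rewrite [leRHS](bigID good) /= lerDl; apply: sumr_ge0 => k _.
  apply: mulr_ge0; first by rewrite exprn_ge0 // invr_ge0 ler0n.
  apply: mulr_ge0 => //; apply: addr_ge0; first exact: sqr_ge0.
  by apply: mulr_ge0; rewrite ?ler0n //; exact: mulr_ge0.
under eq_bigr do rewrite mulrCA mulrDr.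
rewrite -mulr_sumr big_split /= -mulr_suml.
have -> : \sum_(k : {ffun 'I_r0 -> 'I_n}) n%:R^-1 ^+ r0 = 1 :> R.
  have := @sum_draws R n r0 (fun=> n%:R^-1).
  under eq_bigr do rewrite prodr_const card_ord.
  move=> ->; rewrite sumr_const card_ord.
  by rewrite -[X in X ^+ _]mulr_natl mulfV ?expr1n.
rewrite mul1r.
have rR : 0 < r%:R :> R by rewrite ltr0n.
have sE : s = r0%:R + r%:R by rewrite /s natrD.
have r00 : 0 <= r0%:R :> R by rewrite ler0n.
apply: (@le_trans _ _ (2 * s^-1 ^+ 2 * (s * ((1 + C) * mean_sqr)))).
  rewrite ler_wpM2l //.
  apply: (le_trans (lerD pilot_draws_second_moment (lexx _))).
  rewrite sE; have := mulr_ge0 r00 (mulr_ge0 C0 m0).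
  by have := mulr_ge0 (ltW rR) m0; lra.
have -> : 2 * s^-1 ^+ 2 * (s * ((1 + C) * mean_sqr)) =
    2 * (1 + C) * mean_sqr * s^-1.
  by field; rewrite -sE gt_eqF.
have C1 : 0 <= 2 * (1 + C) * mean_sqr by apply: mulr_ge0 => //; lra.
rewrite ler_wpM2l //.
by rewrite lef_pV2 ?posrE // sE lerDr.
Qed.

End ReweightedMean.

(** * The conditional bound for fixed data *)

Section CorrectedEntries.
Context {R : realType} {p : nat} (Suu : 'M[R]_p) (c : R).
Context {J : finType} (om : J -> R) (ws : J -> 'cV[R]_p) (ys : J -> R).

Lemma corrected_gramE a b : corrected_gram Suu c om ws a b =
  c * (\sum_j om j * (ws j a 0 * ws j b 0)) - Suu a b.
Proof.
rewrite !mxE summxE; congr (_ * _ - _); apply: eq_bigr => j _.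
by rewrite !mxE big_ord1 !mxE.
Qed.

Lemma corrected_scoreE b a : corrected_score Suu c om ws ys b a 0 =
  c * (\sum_j om j * ((ys j - dotv (ws j) b) * ws j a 0)) + (Suu *m b) a 0.
Proof.
rewrite !mxE summxE; congr (_ * _ + _); apply: eq_bigr => j _.
by rewrite !mxE mulrA.
Qed.

End CorrectedEntries.

Section ConditionalBound.
Context {R : realType} {p n : nat} (Suu : 'M[R]_p).
Context (w : 'I_n -> 'cV[R]_p) (y : 'I_n -> R) (crit : criterion).
Hypothesis Suu_sym : Suu^T = Suu.

Lemma full_loss_corrected :
  full_loss Suu w y = corrected_loss Suu n%:R^-1 (fun=> 1) w y.
Proof.
apply/funext => b; rewrite /full_loss /corrected_loss invfM -mulrA.
by under [in RHS]eq_bigr do rewrite mul1r.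
Qed.

Lemma HW_corrected : HW Suu w = corrected_gram Suu n%:R^-1 (fun=> 1) w.
Proof. by rewrite /corrected_gram; under eq_bigr do rewrite scale1r. Qed.

Lemma beta_hat_score lam : 0 < lam -> coercive lam (HW Suu w) ->
  corrected_score Suu n%:R^-1 (fun=> 1) w y (beta_hat Suu w y) = 0.
Proof.
move=> lam0; rewrite HW_corrected => cH.
have [b [bmin b0 _]] := corrected_argmin y Suu_sym 0 lam0 cH.
by rewrite /beta_hat full_loss_corrected (argminE bmin).
Qed.

Lemma sub_prob_ge0 b i : 0 <= sub_prob Suu w y crit b i.
Proof.
rewrite /sub_prob divr_ge0 // ?sumr_ge0 // => *;
by rewrite mulr_ge0 // sqrtr_ge0.
Qed.

(** When all scores vanish, division by 0 makes every probability 0. *)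
Lemma sum_sub_prob b : \sum_i sub_prob Suu w y crit b i =
  (\sum_i score Suu w y crit b i != 0)%:R.
Proof.
rewrite /sub_prob -mulr_suml; case: eqVneq => [->|S0]; first by rewrite mul0r.
by rewrite divff.
Qed.

(** A finite bound on the largest inverse probability rules out null
    probabilities, hence also the degenerate case of vanishing scores. *)
Lemma max_inv_probP b C : (0 < n)%N ->
  (max_inv_prob Suu w y crit b <= C%:E)%E ->
  let q := sub_prob Suu w y crit b in
  [/\ \sum_i q i = 1, forall i, 0 < q i & forall i, (n%:R * q i)^-1 <= C].
Proof.
move=> n0 maxC q.
have qC i : n%:R * q i != 0 /\ (n%:R * q i)^-1 <= C.
  have : (((n%:R * q i)%:E)^-1 <= C%:E)%E.
    apply: le_trans maxC.
    exact: (le_bigmax _ (fun i => ((n%:R * q i)%:E)^-1%E)).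
  by rewrite inver; case: eqVneq => // _; rewrite lee_fin.
have q0 i : 0 < q i.
  rewrite lt_def sub_prob_ge0 andbT; have [+ _] := qC i.
  by apply: contraNN => /eqP ->; rewrite mulr0.
split=> // [|i]; last by have [] := qC i.
rewrite sum_sub_prob; case: eqVneq => // S0.
by have := q0 (Ordinal n0); rewrite /q /sub_prob S0 invr0 mulr0 ltxx.
Qed.

Section TwoStepDraws.
Context {r0 r : nat}.
Implicit Types (k : {ffun 'I_r0 -> 'I_n}) (l : {ffun 'I_r -> 'I_n}).

Let om k l j := ((r0 + r)%:R * comb_prob Suu w y crit k l j)^-1.
Let cgram k l :=
  corrected_gram Suu n%:R^-1 (om k l) (fun j => w (comb_idx k l j)).
Let cscore k l := corrected_score Suu n%:R^-1 (om k l)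
  (fun j => w (comb_idx k l j)) (fun j => y (comb_idx k l j)).
Let bhat := beta_hat Suu w y.

Lemma comb_loss_corrected k l : comb_loss Suu w y crit k l =
  corrected_loss Suu n%:R^-1 (om k l)
    (fun j => w (comb_idx k l j)) (fun j => y (comb_idx k l j)).
Proof.
by apply/funext => b; rewrite /comb_loss /weighted_loss invfM -mulrA.
Qed.

Let gram_term a b i : R := w i a 0 * w i b 0.
Let score_term a i : R := (y i - dotv (w i) bhat) * w i a 0.

Definition reweighting_error x k l : R :=
  reweighted_mean Suu w y crit x k l - mean x.

(** The correction by Suu is the same for both criteria and cancels. *)
Lemma comb_gram_dev k l a b :
  cgram k l a b - HW Suu w a b = reweighting_error (gram_term a b) k l.
Proof.
rewrite HW_corrected !corrected_gramE opprD addrACA opprK addNr addr0.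
by congr (_ - _ * _); apply: eq_bigr => i _; rewrite mul1r.
Qed.

(** The full-data score vanishes at the full-data estimator, so it can be
    subtracted for free. *)
Lemma comb_score_dev lam k l a : 0 < lam -> coercive lam (HW Suu w) ->
  cscore k l bhat a 0 = reweighting_error (score_term a) k l.
Proof.
move=> lam0 cH; rewrite -[LHS]subr0.
have /matrixP/(_ a 0) := beta_hat_score lam0 cH; rewrite [X in _ = X]mxE => <-.
rewrite !corrected_scoreE opprD addrACA subrr addr0.
by congr (_ - _ * _); apply: eq_bigr => i _; rewrite mul1r.
Qed.

Lemma comb_estimator_close lam tau k l : 0 < lam -> 0 < tau ->
  coercive lam (HW Suu w) ->
  \sum_a \sum_b reweighting_error (gram_term a b) k l ^+ 2
    < (lam / (2 * (p * p).+1%:R)) ^+ 2 ->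
  \sum_a reweighting_error (score_term a) k l ^+ 2 < (lam / 2 * tau) ^+ 2 ->
  argmin_exists (comb_loss Suu w y crit k l) /\
  enorm (argmin (comb_loss Suu w y crit k l) - bhat) < tau.
Proof.
move=> lam0 tau0 cH; set t := lam / _ => smallH smallg.
have t0 : 0 < t by rewrite divr_gt0 // mulr_gt0.
have Dt a b : `|cgram k l a b - HW Suu w a b| <= t.
  rewrite comb_gram_dev -(@ler_pXn2r _ 2) ?nnegrE ?(ltW t0) //.
  rewrite real_normK ?num_real //.
  rewrite ltW // (le_lt_trans _ smallH) // (bigD1 a) //= (bigD1 b) //=.
  rewrite -addrA lerDl addr_ge0 ?sumr_ge0 // => *; first exact: sqr_ge0.
  by rewrite sumr_ge0 // => *; exact: sqr_ge0.
have cC := coercive_entrywise lam0 cH Dt.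
have lam2 : 0 < lam / 2 by rewrite divr_gt0.
have [b [bmin _ hb]] :=
  corrected_argmin (fun j => y (comb_idx k l j)) Suu_sym bhat lam2 cC.
have cE := comb_loss_corrected k l.
split; first by exists b; rewrite cE.
rewrite cE (argminE bmin) -(@ltr_pXn2r _ 2) ?nnegrE ?sqrtr_ge0 ?(ltW tau0) //.
rewrite sqr_enorm.
have lh : 0 < (lam / 2) ^+ 2 by rewrite exprn_gt0.
rewrite -(ltr_pM2l lh) -exprMn (le_lt_trans hb) // (le_lt_trans _ smallg) //.
rewrite dotvE ler_sum // => a _.
by rewrite -expr2 -/(cscore k l bhat) (comb_score_dev _ _ _ lam0 cH).
Qed.


(** Chebyshev's inequality before taking expectations: on the far event one of
    the two sums of squares exceeds its threshold. *)
Lemma far_indicator_le lam tau k l : 0 < lam -> 0 < tau ->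
  coercive lam (HW Suu w) ->
  (`[< far_event Suu w y crit tau k l >])%:R <=
  (\sum_a \sum_b reweighting_error (gram_term a b) k l ^+ 2)
    / (lam / (2 * (p * p).+1%:R)) ^+ 2
  + (\sum_a reweighting_error (score_term a) k l ^+ 2) / (lam / 2 * tau) ^+ 2.
Proof.
move=> lam0 tau0 cH.
set VH := \sum_a \sum_b _; set Vg := \sum_a _ ^+ 2.
set tH := (lam / (2 * _)) ^+ 2; set tg := (lam / 2 * tau) ^+ 2.
have tH0 : 0 < tH by rewrite exprn_gt0 // divr_gt0 // mulr_gt0.
have tg0 : 0 < tg by rewrite exprn_gt0 // mulr_gt0 // divr_gt0.
have VH0 : 0 <= VH / tH.
  rewrite divr_ge0 ?(ltW tH0) //; apply: sumr_ge0 => a _.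
  by apply: sumr_ge0 => b _; exact: sqr_ge0.
have Vg0 : 0 <= Vg / tg.
  by rewrite divr_ge0 ?(ltW tg0) //; apply: sumr_ge0 => a _; exact: sqr_ge0.
case: asboolP => [[_ far]|_]; last by rewrite addr_ge0.
have [smallH|] := ltP VH tH; last first.
  by rewrite -[leLHS]mul1r -ler_pdivlMr // => h; rewrite (le_trans h) // lerDl.
have [smallg|] := ltP Vg tg; last first.
  by rewrite -[leLHS]mul1r -ler_pdivlMr // => h; rewrite (le_trans h) // lerDr.
have [ex_min close] := comb_estimator_close lam0 tau0 cH smallH smallg.
by case: far => // /(lt_le_trans close); rewrite ltxx.
Qed.

Lemma mean_sqr_gram_le M a b :
  n%:R^-1 * \sum_i enorm (w i) ^+ 4 <= M -> mean_sqr (gram_term a b) <= M.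
Proof.
apply: le_trans; rewrite ler_wpM2l ?invr_ge0 ?ler0n //; apply: ler_sum => i _.
rewrite (exprM _ 2 2) sqr_enorm exprMn expr2.
by rewrite ler_pM ?sqr_ge0 // sqr_entry_le_dotv.
Qed.

Lemma mean_sqr_score_le M a :
  n%:R^-1 * \sum_i enorm (w i) ^+ 4 <= M ->
  n%:R^-1 * \sum_i (y i - dotv (w i) bhat) ^+ 4 <= M ->
  mean_sqr (score_term a) <= M.
Proof.
set mw := n%:R^-1 * _; set me := n%:R^-1 * _ => hw he.
apply: (@le_trans _ _ (2^-1 * (mw + me))); last by lra.
rewrite /mw /me -mulrDr mulrCA -big_split ler_wpM2l ?invr_ge0 ?ler0n //.
rewrite mulr_sumr; apply: ler_sum => i _ /=.
rewrite (exprM _ 2 2) (exprM (y i - _) 2 2) sqr_enorm exprMn.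
set e2 := (y i - _) ^+ 2; have e20 : 0 <= e2 by exact: sqr_ge0.
have := ler_wpM2l e20 (sqr_entry_le_dotv (w i) a).
by have := sqr_ge0 (e2 - dotv (w i) (w i)); rewrite sqrrB; lra.
Qed.

Definition weight_explosion C k : Prop := pilot_exists Suu w y k /\
  (C%:E < max_inv_prob Suu w y crit (pilot Suu w y k))%E.

(** Pilot draws are of three kinds: those without a pilot estimate contribute
    nothing to the far event, those with a large inverse probability
    contribute at most their own probability, and for the others the far
    event is controlled by second moments. *)
Lemma cond_prob_far_le lam tau M C bad : (0 < n)%N -> (0 < r)%N ->
  0 < lam -> 0 < tau -> 0 <= C -> coercive lam (HW Suu w) ->
  n%:R^-1 * \sum_i enorm (w i) ^+ 4 <= M ->
  n%:R^-1 * \sum_i (y i - dotv (w i) bhat) ^+ 4 <= M ->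
  \sum_(k : {ffun 'I_r0 -> 'I_n})
    n%:R^-1 ^+ r0 * (`[< weight_explosion C k >])%:R <= bad ->
  cond_prob Suu w y crit (far_event Suu w y crit (r0 := r0) (r := r) tau)
  <= bad + 2 * (1 + C) * M / r%:R *
     ((p * p)%:R / (lam / (2 * (p * p).+1%:R)) ^+ 2 +
      p%:R / (lam / 2 * tau) ^+ 2).
Proof.
move=> n0 r_gt0 lam0 tau0 C0 cH hw he hbad.
pose good k := `[< pilot_exists Suu w y k >] && ~~ `[< weight_explosion C k >].
have goodP k : good k ->
    let q := sub_prob Suu w y crit (pilot Suu w y k) in
    [/\ \sum_i q i = 1, forall i, 0 < q i & forall i, (n%:R * q i)^-1 <= C].
  move=> /andP[/asboolP kex /asboolPn kC]; apply: max_inv_probP => //.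
  by rewrite leNgt; apply/negP => h; apply: kC.
set tH := (lam / (2 * _)) ^+ 2; set tg := (lam / 2 * tau) ^+ 2.
have tH0 : 0 < tH by rewrite exprn_gt0 // divr_gt0 // mulr_gt0.
have tg0 : 0 < tg by rewrite exprn_gt0 // mulr_gt0 // divr_gt0.
pose c : R := n%:R^-1 ^+ r0.
have c0 : 0 <= c by rewrite exprn_ge0 // invr_ge0 ler0n.
pose Q k l := \prod_(j < r) sub_prob Suu w y crit (pilot Suu w y k) (l j).
have Q0 k l : 0 <= Q k l by apply: prodr_ge0 => j _; exact: sub_prob_ge0.
pose E2 x := \sum_(k : {ffun 'I_r0 -> 'I_n} | good k)
  \sum_(l : {ffun 'I_r -> 'I_n}) c * Q k l * reweighting_error x k l ^+ 2.
have E2le x : mean_sqr x <= M -> E2 x <= 2 * (1 + C) * M / r%:R.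
  move=> xM.
  apply: (le_trans (reweighted_mean_second_moment x n0 r_gt0 C0 goodP)).
  rewrite ler_wpM2r ?invr_ge0 ?ler0n // ler_wpM2l // mulr_ge0 //; lra.
have step k : \sum_(l : {ffun 'I_r -> 'I_n})
     c * Q k l * (`[< far_event Suu w y crit tau k l >])%:R <=
   c * (`[< weight_explosion C k >])%:R +
   if good k then \sum_(l : {ffun 'I_r -> 'I_n}) c * Q k l *
     ((\sum_a \sum_b reweighting_error (gram_term a b) k l ^+ 2) / tH
      + (\sum_a reweighting_error (score_term a) k l ^+ 2) / tg) else 0.
  have [gk|ngk] := boolP (good k).
    rewrite -[leLHS]add0r lerD ?mulr_ge0 ?ler0n //; apply: ler_sum => l _.
    by rewrite ler_wpM2l ?mulr_ge0 //; exact: far_indicator_le.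
  rewrite addr0; move: ngk.
  rewrite /good negb_and negbK => /orP[/asboolPn nex|->].
    rewrite big1 ?mulr_ge0 ?ler0n // => l _; case: asboolP => [[]//|_].
    by rewrite mulr0.
  rewrite mulr1.
  apply: (@le_trans _ _ (c * \sum_(l : {ffun 'I_r -> 'I_n}) Q k l)).
    rewrite mulr_sumr; apply: ler_sum => l _; rewrite ler_piMr ?mulr_ge0 //.
    by case: asboolP.
  rewrite ler_piMr // /Q sum_draws sum_sub_prob.
  by case: (_ != 0); rewrite ?expr1n // expr0n; case: eqP.
apply: (le_trans (ler_sum _ (fun k _ => step k))).
rewrite big_split /= lerD // -big_mkcond /=.
have -> : \sum_(k : {ffun 'I_r0 -> 'I_n} | good k)
    \sum_(l : {ffun 'I_r -> 'I_n}) c * Q k l *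
     ((\sum_a \sum_b reweighting_error (gram_term a b) k l ^+ 2) / tH
      + (\sum_a reweighting_error (score_term a) k l ^+ 2) / tg) =
   (\sum_a \sum_b E2 (gram_term a b)) / tH + (\sum_a E2 (score_term a)) / tg.
  have exch (I : finType) (F : I -> _ -> _ -> R) :
      \sum_(k : {ffun 'I_r0 -> 'I_n} | good k)
        \sum_(l : {ffun 'I_r -> 'I_n}) c * Q k l * \sum_i F i k l =
      \sum_i \sum_(k : {ffun 'I_r0 -> 'I_n} | good k)
        \sum_(l : {ffun 'I_r -> 'I_n}) c * Q k l * F i k l.
    rewrite [RHS]exchange_big /=; apply: eq_bigr => k _.
    by rewrite [RHS]exchange_big /=; apply: eq_bigr => l _; rewrite mulr_sumr.
  under [X in _ = X / _ + _]eq_bigr do rewrite -exch.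
  rewrite -!exch !mulr_suml -big_split; apply: eq_bigr => k _ /=.
  rewrite !mulr_suml -big_split; apply: eq_bigr => l _ /=.
  by rewrite mulrDr !mulrA.
move: (2 * (1 + C) * M / r%:R) E2le => K E2le; rewrite mulrDr !mulrA.
apply: lerD; rewrite ler_pM2r ?invr_gt0 //.
  apply: (@le_trans _ _ (\sum_(a < p) \sum_(b < p) K)).
    apply: ler_sum => a _; apply: ler_sum => b _.
    by apply: E2le; exact: mean_sqr_gram_le.
  by rewrite !sumr_const !card_ord -mulrnA mulr_natr.
apply: (@le_trans _ _ (\sum_(a < p) K)).
  by apply: ler_sum => a _; apply: E2le; exact: mean_sqr_score_le.
by rewrite sumr_const card_ord mulr_natr.
Qed.

End TwoStepDraws.
End ConditionalBound.

(** * Outer probability *)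

Section OuterProbability.
Context {R : realType} {d : measure_display} {T : measurableType d}.
Variable P : probability T R.
Implicit Types A B : set T.

Lemma le_prob A B : A `<=` B -> (prob P A <= prob P B)%E.
Proof. exact: le_mu_ext. Qed.

Lemma prob_ge0 A : (0 <= prob P A)%E.
Proof. exact: outer_measure_ge0. Qed.

Lemma prob_measurable A : measurable A -> prob P A = P A.
Proof. exact: measurable_mu_extE. Qed.

Lemma prob_fin_num A : prob P A \is a fin_num.
Proof.
rewrite ge0_fin_numE ?prob_ge0 // (@le_lt_trans _ _ (prob P setT)) ?le_prob //.
by rewrite prob_measurable // probability_setT ltry.
Qed.

Lemma probU A B : (prob P (A `|` B) <= prob P A + prob P B)%E.
Proof. exact: outer_measureU2. Qed.

Lemma prob_exists (I : finType) (A : I -> set T) :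
  (prob P [set t | exists i, A i t] <= \sum_i prob P (A i))%E.
Proof.
suff H s : (prob P [set t | exists2 i, i \in s & A i t]
    <= \sum_(i <- s) prob P (A i))%E.
  rewrite -big_enum (le_trans _ (H _)) //; apply: le_prob => t [i Ai].
  by exists i; rewrite ?mem_enum.
elim: s => [|i s IH].
  rewrite big_nil -(mu_ext0 (measure0 P) (measure_ge0 P)).
  by apply: le_prob => t [].
rewrite big_cons (le_trans _ (leeD2l _ IH)) // (le_trans _ (probU _ _)) //.
apply: le_prob => t [j]; rewrite inE => /orP[/eqP ->|js] Aj; first by left.
by right; exists j.
Qed.

Lemma prob_measurable_cover A (e : R) : 0 < e ->
  exists B, [/\ measurable B, A `<=` B & (P B <= prob P A + e%:E)%E].
Proof.
move=> e0.
have [_ [F [mF AF] <-] ltF] :=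
  lb_ereal_inf_adherent e0 (prob_fin_num A).
exists (\bigcup_k F k); split => //; first exact: bigcup_measurable.
apply: le_trans (ltW ltF); apply: measure_sigma_subadditive => //.
exact: bigcup_measurable.
Qed.

(** Each event is enlarged to a measurable cover of almost the same
    probability; Markov's inequality is then applied to the weighted sum of
    the indicators of the covers. *)
Lemma outer_markov (I : finType) (c : I -> R) (E : I -> set T) (a : R) :
  0 < a -> (forall i, 0 <= c i) ->
  (a%:E * prob P [set t | (a <= \sum_i c i * (`[< E i t >])%:R)%R]
   <= \sum_i (c i)%:E * prob P (E i))%E.
Proof.
move=> a0 c0; apply/lee_addgt0Pr => e e0.
have c1 : 0 < 1 + \sum_i c i by rewrite ltr_wpDr // sumr_ge0.
pose e' := e / (1 + \sum_i c i); have e'0 : 0 < e' by rewrite divr_gt0.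
have /choice[B /all_and3[mB EB PB]] i := prob_measurable_cover (E i) e'0.
pose f t : R := \sum_i c i * \1_(B i) t.
have mci i : measurable_fun setT (fun t => c i * \1_(B i) t : R).
  by apply: measurable_funM => //; exact: measurable_indic.
have mf : measurable_fun setT f by exact: measurable_sum.
have mEf : measurable_fun setT (EFin \o f) by exact/measurable_EFinP.
have f0 t : 0 <= f t by apply: sumr_ge0 => i _; rewrite mulr_ge0.
have mS : measurable [set t | (a <= f t)%R].
  rewrite (_ : [set t | _] = f @^-1` `[a, +oo[); last first.
    by apply/seteqP; split => t /=; rewrite in_itv /= andbT.
  by rewrite -[X in measurable X]setTI; exact: mf.
apply: (@le_trans _ _ (a%:E * P [set t | (a <= f t)%R])%E).
  rewrite lee_pmul2l // -prob_measurable //.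
  apply: le_prob => t /= /le_trans; apply.
  apply: ler_sum => i _; rewrite ler_wpM2l // ler_nat.
  case: asboolP => // /EB Bt; by rewrite mem_set.
apply: (@le_trans _ _ (\int[P]_t (f t)%:E)%E).
  have := @le_integral_comp_abse _ _ _ P _ measurableT (EFin \o f) a id
    (@measurable_id _ _ _) (fun _ => id) (fun _ _ _ _ => id).
  move=> /(_ mEf a0).
  rewrite setTI (_ : [set x | _] = [set t | (a <= f t)%R]); last first.
    by apply/seteqP; split => t /=; rewrite lee_fin ger0_norm.
  move=> /le_trans; apply; rewrite le_eqVlt; apply/orP; left; apply/eqP.
  by apply: eq_integral => t _ /=; rewrite ger0_norm.
have -> : (\int[P]_t (f t)%:E = \sum_i (c i)%:E * P (B i))%E.
  under eq_integral do rewrite /f -sumEFin.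
  rewrite ge0_integral_sum //=.
  - apply: eq_bigr => i _; under eq_integral do rewrite EFinM.
    rewrite ge0_integralZl_EFin //.
      by rewrite integral_indic // setIT.
    by apply/measurable_EFinP; exact: measurable_indic.
  - by move=> i; apply/measurable_EFinP.
  - by move=> i t _; rewrite lee_fin mulr_ge0.
apply: (@le_trans _ _ (\sum_i ((c i)%:E * prob P (E i) + (c i * e')%:E))%E).
  apply: lee_sum => i _; rewrite EFinM -muleDr ?fin_num_adde_defl //.
  by rewrite lee_wpmul2l ?lee_fin.
rewrite big_split /= leeD2l // sumEFin lee_fin -mulr_suml /e'.
by rewrite mulrCA ler_piMr ?(ltW e0) // ler_pdivrMr // mul1r lerDr.
Qed.

End OuterProbability.

(** * Convergence of the two-step estimator *)

Unset Implicit Arguments.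
Set Strict Implicit.
Set Printing Implicit Defensive.

Theorem theorem4 (R : realType) (d : measure_display) (T : measurableType d)
  (P : probability T R) (p : nat)
  (beta : 'cV[R]_p) (Suu : 'M[R]_p) (sigma : R)
  (X U : nat -> 'I_p -> {RV P >-> R}) (eps : nat -> {RV P >-> R})
  (crit : criterion) (r0 : nat -> nat)
  (model : errors_in_variables_model Suu sigma X U eps)
  (A1 : exists H : 'M[R]_p, posdef H /\
     forall a b : 'I_p,
       cvg_in_prob P (fun n t => HW Suu (W X U (n:=n) t) a b) (H a b))
  (A2W : bounded_in_prob P (fun n t =>
     n%:R^-1 * \sum_(i < n) enorm (W X U t i) ^+ 4))
  (A2e : bounded_in_prob P (fun n t =>
     n%:R^-1 * \sum_(i < n)
       (Y beta X eps t i -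
        dotv (W X U t i)
          (beta_hat Suu (W X U (n:=n) t) (Y beta X eps (n:=n) t))) ^+ 4))
  (A3 : forall delta : R, 0 < delta ->
     exists C : R, \forall n \near \oo,
       (joint_prob P (fun k : {ffun 'I_(r0 n) -> 'I_n} =>
          [set t | let w := W X U (n:=n) t in
                   let y := Y beta X eps (n:=n) t in
                   pilot_exists Suu w y k /\
                   (C%:E < max_inv_prob Suu w y crit (pilot Suu w y k))%E])
        <= delta%:E)%E) :
  forall epsilon delta : R, 0 < epsilon -> 0 < delta ->
    exists (Delta : R) (r_eps : nat) (eta : R), 0 < eta /\
      \forall n \near \oo,
        (prob P (~` [set t | let w := W X U (n:=n) t in
                             let y := Y beta X eps (n:=n) t in
           forall r : nat, (r_eps < r)%N ->
             ((r0 n)%:R / Num.sqrt r%:R < eta)%R ->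
             (cond_prob Suu w y crit
               (far_event Suu w y crit (r0:=r0 n) (r:=r)
                  ((Num.sqrt r%:R)^-1 * Delta)) < epsilon)%R])
         <= delta%:E)%E.
Proof.
move=> epsilon delta eps0 delta0.
(* symmetry of Suu makes the score the gradient of the loss *)
have Suu_sym : Suu^T = Suu.
  apply/matrixP => a b; rewrite mxE; have [[_ _ _ _ covU] _] := model 0.
  by apply: EFin_inj; rewrite -!covU covarianceC.
have [H [Hpd A1H]] := A1.
have [lam0 lam0_gt0 cH] := posdef_coercive Hpd.
set tol := lam0 / (2 * (p * p).+1%:R).
have tol0 : 0 < tol by rewrite divr_gt0 // mulr_gt0.
have d4 : 0 < delta / 4 by rewrite divr_gt0.
pose d1 := delta / 4 / (p * p).+1%:R.
have d10 : 0 < d1 by rewrite divr_gt0.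
have A1n : \forall n \near \oo, forall ab : 'I_p * 'I_p,
    (prob P [set t |
       (tol <= `|HW Suu (W X U (n:=n) t) ab.1 ab.2 - H ab.1 ab.2|)%R]
     <= d1%:E)%E.
  apply: filter_forall => -[a b] /=.
  apply: (A1H a b tol tol0 [set x | (x <= d1%:E)%E]).
  have : nbhs (0%E : \bar R) [set x | (x < d1%:E)%E].
    apply: open_nbhs_nbhs.
    by split; [exact: open_ereal_lt_ereal|rewrite /= lte_fin].
  by apply: filterS => x /ltW.
have [M1 A2Wn] := A2W _ d4.
have [M2 A2en] := A2e _ d4.
have [C0 A3n] := A3 _ (mulr_gt0 d4 (divr_gt0 eps0 (ltr0n R 2))).
pose C := `|C0|; pose M := `|M1| + `|M2|; pose lam := lam0 / 2.
have lam_gt0 : 0 < lam by rewrite divr_gt0.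
pose K := 2 * (1 + C) * M.
have C_ge0 : 0 <= C by exact: normr_ge0.
have K0 : 0 <= K.
  by rewrite mulr_ge0 ?mulr_ge0 ?addr_ge0.
pose tH := (lam / (2 * (p * p).+1%:R)) ^+ 2.
have tH0 : 0 < tH by rewrite exprn_gt0 // divr_gt0 // mulr_gt0.
(* r > xr makes the Hessian term at most epsilon / 4, and (1 + xD)^2 >= xD
   does the same for the gradient term, where r cancels *)
pose xr := 4 * (K * (p * p)%:R) / (tH * epsilon).
have xr0 : 0 <= xr.
  apply: divr_ge0; last by rewrite mulr_ge0 ?(ltW tH0) ?(ltW eps0).
  by rewrite mulr_ge0 // mulr_ge0.
pose xD := 4 * (K * p%:R) / epsilon.
have xD0 : 0 <= xD.
  by rewrite divr_ge0 ?(ltW eps0) // mulr_ge0 // mulr_ge0.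
pose Delta := (1 + xD) / (lam / 2).
have Delta0 : 0 < Delta by rewrite divr_gt0 ?divr_gt0 // ltr_wpDr.
exists Delta, (Num.bound xr), 1; split => //.
pose w n t := W X U (n:=n) t; pose y n t := Y beta X eps (n:=n) t.
pose B1 n := [set t | exists ab : 'I_p * 'I_p,
  (tol <= `|HW Suu (w n t) ab.1 ab.2 - H ab.1 ab.2|)%R].
pose B2 n := [set t | (M1 < `|n%:R^-1 * \sum_(i < n) enorm (w n t i) ^+ 4|)%R].
pose B3 n := [set t | (M2 < `|n%:R^-1 * \sum_(i < n)
  (y n t i - dotv (w n t i) (beta_hat Suu (w n t) (y n t))) ^+ 4|)%R].
pose B4 n := [set t | (epsilon / 2 <= \sum_(k : {ffun 'I_(r0 n) -> 'I_n})
  n%:R^-1 ^+ r0 n *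
  (`[< weight_explosion Suu (w n t) (y n t) crit C k >])%:R)%R].
have pB1 : \forall n \near \oo, (prob P (B1 n) <= (delta / 4)%:E)%E.
  move: A1n; apply: filterS => n A1n; apply: (le_trans (prob_exists _ _)).
  apply: (@le_trans _ _ (\sum_(ab : 'I_p * 'I_p) d1%:E)%E).
    by apply: lee_sum => ab _; exact: A1n.
  rewrite sumEFin lee_fin sumr_const card_prod card_ord -[d1 *+ _]mulr_natr /d1.
  by rewrite -mulrA ler_piMr ?(ltW d4) // mulrC ler_pdivrMr // mul1r ler_nat.
have pB4 : \forall n \near \oo, (prob P (B4 n) <= (delta / 4)%:E)%E.
  have e2 : 0 < epsilon / 2 by rewrite divr_gt0.
  move: A3n; apply: filterS => n A3n.
  rewrite -(@lee_pmul2l _ (epsilon / 2)%:E) ?lte_fin //.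
  apply: le_trans (outer_markov _ _ e2 _) _ => [k|].
    by rewrite exprn_ge0 // invr_ge0 ler0n.
  rewrite -EFinM [(_ / 2 * _)%R]mulrC; apply: le_trans A3n.
  apply: lee_sum => k _.
  rewrite lee_wpmul2l ?lee_fin ?exprn_ge0 ?invr_ge0 ?ler0n //.
  apply: le_prob => t [kex Ck]; split => //; apply: le_lt_trans Ck.
  by rewrite lee_fin ler_norm.
near=> n; have n0 : (0 < n)%N by near: n; exact: nbhs_infty_gt.
apply: (@le_trans _ _ (prob P (B1 n `|` (B2 n `|` (B3 n `|` B4 n))))); last first.
  have -> : delta = delta / 4 + (delta / 4 + (delta / 4 + delta / 4)) by lra.
  rewrite !EFinD.
  apply: (le_trans (probU _ _ _)); apply: leeD; first by near: n.
  apply: (le_trans (probU _ _ _)); apply: leeD; first by near: n.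
  by apply: (le_trans (probU _ _ _)); apply: leeD; near: n.
apply: le_prob => t /=; apply: contra_notP.
move=> /not_orP[nB1 /not_orP[nB2 /not_orP[nB3 nB4]]].
move=> r rlarge _.
have r_gt0 : (0 < r)%N by apply: leq_ltn_trans rlarge.
have rR : 0 < r%:R :> R by rewrite ltr0n.
have sr0 : 0 < Num.sqrt r%:R :> R by rewrite sqrtr_gt0.
have cHW : coercive lam (HW Suu (w n t)).
  apply: (coercive_entrywise lam0_gt0 cH) => a b.
  rewrite leNgt; apply/negP => h; apply: nB1; exists (a, b); exact: ltW.
have hw : n%:R^-1 * \sum_(i < n) enorm (w n t i) ^+ 4 <= M.
  move/negP: nB2; rewrite -leNgt => /(le_trans (ler_norm _)) h.
  by rewrite (le_trans h) // /M (le_trans (ler_norm _)) // lerDl.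
have he : n%:R^-1 * \sum_(i < n)
    (y n t i - dotv (w n t i) (beta_hat Suu (w n t) (y n t))) ^+ 4 <= M.
  move/negP: nB3; rewrite -leNgt => /(le_trans (ler_norm _)) h.
  by rewrite (le_trans h) // /M (le_trans (ler_norm _)) // lerDr.
have tau0 : 0 < (Num.sqrt r%:R)^-1 * Delta by rewrite mulr_gt0 ?invr_gt0.
move/negP: nB4; rewrite -ltNge => hbad.
apply: le_lt_trans (cond_prob_far_le (crit := crit) (r0 := r0 n) Suu_sym n0
  r_gt0 lam_gt0 tau0 C_ge0 cHW hw he (lexx _)) _.
rewrite -/C -/K -/tH.
have -> : epsilon = epsilon / 2 + (epsilon / 4 + epsilon / 4) by lra.
apply: ltr_leD => //; rewrite mulrDr; apply: lerD.
  rewrite mulf_div ler_pdivrMr ?mulr_gt0 //.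
  have := archi_boundP xr0; rewrite /xr ltr_pdivrMr ?mulr_gt0 // => h.
  have rl : (Num.bound xr)%:R <= r%:R :> R by rewrite ler_nat ltnW.
  have := ler_wpM2r (ltW (mulr_gt0 tH0 eps0)) rl.
  by move: h; rewrite -/xr; lra.
have -> : lam / 2 * ((Num.sqrt r%:R)^-1 * Delta) = (Num.sqrt r%:R)^-1 * (1 + xD).
  by rewrite mulrCA /Delta [lam / 2 * _]mulrC divfK // gt_eqF // divr_gt0.
rewrite exprMn exprVn sqr_sqrtr ?(ltW rR) //.
have D0 : 0 < 1 + xD by rewrite ltr_wpDr.
have -> : K / r%:R * (p%:R / (r%:R^-1 * (1 + xD) ^+ 2)) = K * p%:R / (1 + xD) ^+ 2.
  by field; rewrite (gt_eqF D0) (gt_eqF rR).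
rewrite ler_pdivrMr ?exprn_gt0 //.
have <- : epsilon / 4 * xD = K * p%:R by rewrite /xD; field; rewrite gt_eqF.
rewrite ler_wpM2l ?divr_ge0 ?(ltW eps0) //.
by have := sqr_ge0 xD; rewrite sqrrD; lra.
Unshelve. all: by end_near. Qed.
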